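(* Consider the $N$-round game corresponding to Polya's urn model, with an urn of $\nu_1>0$ red balls and $\nu_2>0$ black balls, $\nu_1+\nu_2\ge N$, in which at each draw the drawn ball is replaced and $c$ balls of the same color are added. The number $c$ need not be positive ($c=0$ and $c=-1$ are included), and Forecaster's prices are understood to lie in $[0,1]$. Let $S_N=x_1+\dots+x_N$ and let $\eta:\{0,\dots,N\}\to\mathbb R$ be any function. Then the upper and lower expected values of $\eta(S_N)$ coincide and are given by $$\overline{\mathbb E}(\eta(S_N))=\underline{\mathbb E}(\eta(S_N))=\sum_{m=0}^N\eta(m)\,\frac{\binom{-\nu_1/c}{m}\binom{-\nu_2/c}{N-m}}{\binom{-(\nu_1+\nu_2)/c}{N}}.$$ The case $c=0$ (the right-hand side being read as its limit as $c\to0$) is the binomial formula $$\sum_{m=0}^N\binom Nm p^m(1-p)^{N-m}\eta(m),\qquad p=\frac{\nu_1}{\nu_1+\nu_2},$$ and the case $c=-1$ (sampling without replacement) is the hypergeometric formula $$\sum_{m=\max(0,N-\nu_2)}^{\min(\nu_1,N)}\eta(m)\,\frac{\binom{\nu_1}{m}\binom{\nu_2}{N-m}}{\binom{\nu_1+\nu_2}{N}}.$$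
   Context: For real $t$ and a nonnegative integer $k$, $\binom tk=\frac{t(t-1)\cdots(t-k+1)}{k!}$. Polya's urn game: an initial capital $\mathcal K_0\in\mathbb R$ and $\nu_1>0$, $\nu_2>0$ with $\nu_1+\nu_2\ge N$, and $c$, are given, and $S_0=0$. In each round $n=1,\dots,N$, Forecaster announces $$p_n=\frac{\nu_1+cS_{n-1}}{\nu_1+\nu_2+(n-1)c},$$ then Skeptic announces $M_n\in\mathbb R$, then Reality announces $x_n\in\{0,1\}$; Skeptic's capital is updated by $\mathcal K_n=\mathcal K_{n-1}+M_n(x_n-p_n)$ and $S_n=S_{n-1}+x_n$. That the prices lie in $[0,1]$ means that $p_n$ is well defined and $0\le p_n\le1$ after every sequence of moves of Reality in which she has never chosen $x_k=1$ when $p_k=0$ nor $x_k=0$ when $p_k=1$; this is automatic for $c\ge0$, and also for $c=-1$ with $\nu_1,\nu_2$ integers. A path is a sequence $\xi=x_1\dots x_N$ of Reality's moves. A strategy $\mathcal P$ of Skeptic specifies each $M_n$ as a function of Reality's previous moves $x_1,\dots,x_{n-1}$. $\mathcal K^{\mathcal P}_n(\xi)$ denotes Skeptic's capital after round $n$ along $\xi$ when he uses $\mathcal P$ with initial capital $0$. For a random variable, i.e. a real-valued function $x(\xi)$ of the path, $$\overline{\mathbb E}x=\inf\{\alpha\in\mathbb R \mid \exists\mathcal P\ \forall\xi:\ \mathcal K^{\mathcal P}_N(\xi)\ge x(\xi)-\alpha\},$$ $$\underline{\mathbb E}x=\sup\{\alpha\in\mathbb R \mid \exists\mathcal P\ \forall\xi:\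 \mathcal K^{\mathcal P}_N(\xi)\ge \alpha-x(\xi)\}.$$
   Formalization: The hypergeometric formula for c=-1 is stated for integer ν1, ν2 only; with its summation limits it fails for non-integers such as ν1=1.5, ν2=2, N=2, where the general formula (stated for all real ν1, ν2) still applies. *)

(* Defs.v *)
From mathcomp Require Import all_boot all_order all_algebra.
From mathcomp Require Import all_classical all_reals all_analysis.

Set Implicit Arguments.
Unset Strict Implicit.
Unset Printing Implicit Defensive.

Import Order.TTheory GRing.Theory Num.Theory.
Import numFieldNormedType.Exports.

Local Open Scope classical_set_scope.
Local Open Scope ring_scope.

(* Reality's moves are booleans, [true] standing for x_n = 1 (a red ball).  A
   [seq bool] is the situation reached after finitely many moves; a path of the
   N-round game is an [N.-tuple bool].  The n-th move of the path xi is
   [nth false xi n.-1] and it is made in the situation [take n.-1 xi]. *)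

Definition ones (s : seq bool) : nat := (\sum_(x <- s) nat_of_bool x)%N.

(* The denominator of the price announced in the situation s: here
   [size s] = n - 1. *)
Definition urn_total (R : realType) (nu1 nu2 c : R) (s : seq bool) : R :=
  nu1 + nu2 + (size s)%:R * c.

Definition price (R : realType) (nu1 nu2 c : R) (s : seq bool) : R :=
  (nu1 + c * (ones s)%:R) / urn_total nu1 nu2 c s.

Definition unsurprising (R : realType) (nu1 nu2 c : R) (s : seq bool) : Prop :=
  forall k : nat, (k < size s)%N ->
    ~ (nth false s k = true /\ price nu1 nu2 c (take k s) = 0) /\
    ~ (nth false s k = false /\ price nu1 nu2 c (take k s) = 1).

(* Division by 0 is total, so that the price is well defined has to be said
   separately. *)
Definition prices_in_01 (R : realType) (nu1 nu2 c : R) (N : nat) : Prop :=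
  forall s : seq bool, (size s < N)%N -> unsurprising nu1 nu2 c s ->
    urn_total nu1 nu2 c s != 0 /\ 0 <= price nu1 nu2 c s <= 1.

(* [P s] is the move M_n of Skeptic in the situation s, with n = (size s).+1. *)
Definition strategy (R : realType) := seq bool -> R.

Fixpoint capital (R : realType) (nu1 nu2 c : R) (P : strategy R) (K0 : R)
    (xi : seq bool) (n : nat) : R :=
  if n is n'.+1 then
    capital nu1 nu2 c P K0 xi n' +
    P (take n' xi) * ((nth false xi n')%:R - price nu1 nu2 c (take n' xi))
  else K0.

(* The infimum and the supremum are taken in the extended reals, so that
   equality with a real number excludes the empty and the unbounded case. *)
Definition upperE (R : realType) (nu1 nu2 c : R) (N : nat)
    (x : N.-tuple bool -> R) : \bar R :=
  ereal_inf [set a%:E | a in [set a : R | exists P : strategy R,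
    forall xi : N.-tuple bool, capital nu1 nu2 c P 0 xi N >= x xi - a]].

Definition lowerE (R : realType) (nu1 nu2 c : R) (N : nat)
    (x : N.-tuple bool -> R) : \bar R :=
  ereal_sup [set a%:E | a in [set a : R | exists P : strategy R,
    forall xi : N.-tuple bool, capital nu1 nu2 c P 0 xi N >= a - x xi]].

(* The random variable eta(S_N); [inord] is faithful as S_N <= N. *)
Definition eta_ones (R : realType) (N : nat) (eta : 'I_N.+1 -> R)
    (xi : N.-tuple bool) : R :=
  eta (inord (ones xi)).

Definition gbinom (R : realType) (t : R) (k : nat) : R :=
  (\prod_(i < k) (t - i%:R)) / (k`!)%:R.

Definition polya_formula (R : realType) (nu1 nu2 : R) (N : nat)
    (eta : 'I_N.+1 -> R) (c : R) : R :=
  \sum_(m < N.+1) eta m *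
    (gbinom (- nu1 / c) m * gbinom (- nu2 / c) (N - m)
     / gbinom (- (nu1 + nu2) / c) N).

Definition binomial_formula (R : realType) (nu1 nu2 : R) (N : nat)
    (eta : 'I_N.+1 -> R) : R :=
  let p := nu1 / (nu1 + nu2) in
  \sum_(m < N.+1) 'C(N, m)%:R * p ^+ m * (1 - p) ^+ (N - m) * eta m.

(* Subtraction of naturals is truncated: [N - n2] is max(0, N - n2). *)
Definition hypergeometric_formula (R : realType) (n1 n2 : nat) (N : nat)
    (eta : 'I_N.+1 -> R) : R :=
  \sum_(m < N.+1 | (N - n2 <= m <= minn n1 N)%N) eta m *
    ('C(n1, m)%:R * 'C(n2, N - m)%:R / 'C(n1 + n2, N)%:R).

(* Main.v *)
Require Import Defs.
From mathcomp Require Import all_boot all_order all_algebra.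
From mathcomp Require Import all_classical all_reals all_analysis.
From mathcomp Require Import ring lra zify.

Set Implicit Arguments.
Unset Strict Implicit.
Unset Printing Implicit Defensive.

Import Order.TTheory GRing.Theory Num.Theory.
Import numFieldNormedType.Exports.

Local Open Scope classical_set_scope.
Local Open Scope ring_scope.

(* A function U of the situation that equals the payoff on full paths and is the
   price-weighted average of its two successors determines the game: staking
   U(s,1) - U(s,0) replicates it from the capital U([::]), and no cheaper
   superhedge exists.  Only situations without surprises need the averaging
   property, since at a price 0 or 1 Skeptic can stake arbitrarily much against
   the impossible move for free.  For Polya's urn such a U is explicit: from an
   urn of a red and b black balls sampled k times, the number of red draws is
   distributed with weights C(k,j) a^[j] b^[k-j] / (a+b)^[k], where
   a^[j] = a (a+c) ... (a+(j-1)c), and Pascal's rule is the averaging property.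
   Since (-a/c choose j) = (-1/c)^j a^[j] / j!, these weights are those of the
   theorem, and in this form they are continuous at c = 0. *)

(** * The game *)

Lemma ones_rcons (s : seq bool) (b : bool) : ones (rcons s b) = (ones s + b)%N.
Proof. by rewrite /ones -cats1 big_cat big_seq1. Qed.

(** [(~~ b)%:R] is the one price at which the move [b] is a surprise: 0 for [true], 1 for
    [false]. *)
Lemma unsurprising_rcons (R : realType) (nu1 nu2 c : R) (s : seq bool)
    (b : bool) :
  unsurprising nu1 nu2 c (rcons s b) <->
  unsurprising nu1 nu2 c s /\ price nu1 nu2 c s != (~~ b)%:R.
Proof.
have priceb : (~ (b = true /\ price nu1 nu2 c s = 0) /\
    ~ (b = false /\ price nu1 nu2 c s = 1)) <->
    price nu1 nu2 c s != (~~ b)%:R.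
  case: b => /=; split.
  - by case=> n0 _; apply/eqP => p0; apply: n0.
  - by move/eqP=> n0; split=> [[]|[]].
  - by case=> _ n1; apply/eqP => p1; apply: n1.
  - by move/eqP=> n1; split=> [[]|[]].
rewrite -priceb; split=> [us|[us usb] k].
  split=> [k ks|]; last first.
    have := us (size s); rewrite size_rcons ltnSn nth_rcons ltnn eqxx.
    by rewrite -cats1 take_size_cat //; apply.
  have := us k; rewrite size_rcons ltnS (ltnW ks) nth_rcons ks -cats1.
  by rewrite takel_cat 1?ltnW //; apply.
rewrite size_rcons ltnS leq_eqVlt => /predU1P[->|ks].
  by rewrite nth_rcons ltnn eqxx -cats1 take_size_cat.
by rewrite nth_rcons ks -cats1 takel_cat 1?ltnW //; apply: us.
Qed.

Lemma capital_take (R : realType) (nu1 nu2 c K0 : R) (P : strategy R)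
    (s t : seq bool) (n : nat) : (n <= size s)%N ->
  capital nu1 nu2 c P K0 (s ++ t) n = capital nu1 nu2 c P K0 s n.
Proof.
elim: n => //= n IHn ns; rewrite IHn 1?ltnW //.
by rewrite takel_cat 1?ltnW // nth_cat ns.
Qed.

Lemma capital_rcons (R : realType) (nu1 nu2 c K0 : R) (P : strategy R)
    (s : seq bool) (b : bool) :
  capital nu1 nu2 c P K0 (rcons s b) (size (rcons s b)) =
  capital nu1 nu2 c P K0 s (size s) + P s * (b%:R - price nu1 nu2 c s).
Proof.
rewrite size_rcons /= -cats1 capital_take // take_size_cat //.
by rewrite nth_cat ltnn subnn.
Qed.

Definition fair_value (R : realType) (nu1 nu2 c : R) (N : nat)
    (x : N.-tuple bool -> R) (U : seq bool -> R) : Prop :=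
  (forall xi : N.-tuple bool, U xi = x xi) /\
  forall s, (size s < N)%N -> unsurprising nu1 nu2 c s ->
    U s = price nu1 nu2 c s * U (rcons s true) +
          (1 - price nu1 nu2 c s) * U (rcons s false).

(** Hedging [a - x] means superhedging [- x] from the capital [- a], so lower expectations reduce to
    upper ones. *)
Lemma fair_valueN (R : realType) (nu1 nu2 c : R) (N : nat)
    (x : N.-tuple bool -> R) (U : seq bool -> R) :
  fair_value nu1 nu2 c x U ->
  fair_value nu1 nu2 c (fun xi => - x xi) (fun s => - U s).
Proof.
case=> Ux Urec; split=> [xi|s sN us]; first by rewrite Ux.
by rewrite (Urec s sN us); ring.
Qed.

(* Descending from the full paths to [::] through unsurprising situations
   only: a branch of price 0 does not contribute to the average. *)
Lemma fair_value_le_superhedge (R : realType) (nu1 nu2 c : R) (N : nat)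
    (x : N.-tuple bool -> R) (U : seq bool -> R) (P : strategy R) (a : R) :
  prices_in_01 nu1 nu2 c N -> fair_value nu1 nu2 c x U ->
  (forall xi : N.-tuple bool, capital nu1 nu2 c P 0 xi N >= x xi - a) ->
  U [::] <= a.
Proof.
move=> p01 [Ux Urec] hedge.
suff main k s : (size s + k = N)%N -> unsurprising nu1 nu2 c s ->
    U s <= capital nu1 nu2 c P 0 s (size s) + a.
  by have := main N [::]; rewrite /= add0r; apply.
elim: k s => [|k IHk] s.
  rewrite addn0 => sN _; move/eqP: (sN) => sN'.
  have := hedge (Tuple sN'); rewrite -Ux /= -{1}sN; lra.
move=> sN us; have sltN : (size s < N)%N by rewrite -sN addnS ltnS leq_addr.
have [_ /andP[p0 p1]] := p01 s sltN us.
rewrite (Urec s sltN us).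
set p := price _ _ _ _ in p0 p1 *; set K := capital _ _ _ _ _ _ _.
have step b (w : R) : 0 <= w -> (w != 0 -> p != (~~ b)%:R) ->
    w * U (rcons s b) <= w * (K + P s * (b%:R - p) + a).
  rewrite le_eqVlt => /predU1P[<- _|w0 pb]; first by rewrite !mul0r.
  apply: ler_wpM2l; first exact: ltW.
  rewrite /K /p -capital_rcons; apply: IHk; first by rewrite size_rcons addSnnS.
  by apply/unsurprising_rcons; split=> //; apply: pb; rewrite gt_eqF.
(* When the two weighted bounds are added, the stake cancels because p(1 - p) + (1 - p)(0 - p) =
   0. *)
have := step true p p0 id.
have := step false (1 - p); rewrite subr_ge0 => /(_ p1).
rewrite subr_eq0 eq_sym => /(_ id) /=; nra.
Qed.

(* At a sure price the stake is chosen so large that a surprise alone covers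
   every payoff; after a surprise Skeptic stops betting. *)
Lemma fair_value_superhedge (R : realType) (nu1 nu2 c : R) (N : nat)
    (x : N.-tuple bool -> R) (U : seq bool -> R) :
  fair_value nu1 nu2 c x U ->
  exists P : strategy R,
    forall xi : N.-tuple bool, capital nu1 nu2 c P 0 xi N >= x xi - U [::].
Proof.
move=> [Ux Urec]; pose B := \sum_(xi : N.-tuple bool) `|x xi|.
have xB xi : x xi <= B.
  rewrite (le_trans (ler_norm _)) // /B (bigD1 xi) //= lerDl.
  by apply: sumr_ge0.
pose p := price nu1 nu2 c.
(* At a sure price the sure move costs nothing, while a surprise wins exactly [B - U s], lifting the
   capital from [U s - U [::]] to [B - U [::]]. *)
pose P s := if ~~ `[< unsurprising nu1 nu2 c s >] then 0
  else if p s == 0 then B - U s else if p s == 1 then U s - B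
  else U (rcons s true) - U (rcons s false).
exists P.
suff main s : (size s <= N)%N ->
    (unsurprising nu1 nu2 c s ->
       capital nu1 nu2 c P 0 s (size s) = U s - U [::]) /\
    (~ unsurprising nu1 nu2 c s ->
       capital nu1 nu2 c P 0 s (size s) = B - U [::]).
  move=> xi; have := main xi; rewrite size_tuple => /(_ (leqnn _))[ok surprise].
  have [us|ns] := pselect (unsurprising nu1 nu2 c xi).
    by rewrite ok // Ux.
  by rewrite surprise // lerB.
elim/last_ind: s => [_|s b IHs]; first by split=> [_|[]] //=; rewrite subrr.
rewrite size_rcons => sN; have [ok surprise] := IHs (ltnW sN).
rewrite -(size_rcons s b) capital_rcons.
have [us|ns] := pselect (unsurprising nu1 nu2 c s); last first.
  have -> : P s = 0 by rewrite /P asboolF.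
  rewrite mul0r addr0; split=> [/unsurprising_rcons[]|_] //.
  exact: surprise.
have Us := Urec s sN us; rewrite ok //.
have -> : P s = if p s == 0 then B - U s else if p s == 1 then U s - B
  else U (rcons s true) - U (rcons s false) by rewrite /P asboolT.
rewrite -/(p s) in Us *.
have iffb := unsurprising_rcons nu1 nu2 c s b; rewrite -/(p s) in iffb.
split=> [/iffb[_]|nb].
  have [p0|p0] := eqVneq (p s) 0.
    by move: Us; rewrite p0; case: b {iffb} => /=; rewrite ?eqxx // => -> _; ring.
  have [p1|p1] := eqVneq (p s) 1.
    by move: Us; rewrite p1; case: b {iffb} => /=; rewrite ?eqxx // => -> _; ring.
  by rewrite Us; case: b {iffb} => _ /=; ring.
have {nb iffb} : p s = (~~ b)%:R.
  by apply/eqP/negPn/negP => pb; apply/nb/iffb.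
by case: b => /= ->; rewrite ?eqxx ?oner_eq0; ring.
Qed.

Lemma fair_value_upperE (R : realType) (nu1 nu2 c : R) (N : nat)
    (x : N.-tuple bool -> R) (U : seq bool -> R) :
  prices_in_01 nu1 nu2 c N -> fair_value nu1 nu2 c x U ->
  upperE nu1 nu2 c x = (U [::])%:E.
Proof.
move=> p01 fU; apply/eqP; rewrite eq_le; apply/andP; split.
  apply: ereal_inf_lbound; exists (U [::]) => //.
  exact: fair_value_superhedge fU.
apply: le_ereal_inf_tmp => _ [a [P hedge] <-]; rewrite lee_fin.
exact: fair_value_le_superhedge p01 fU hedge.
Qed.

Lemma fair_value_lowerE (R : realType) (nu1 nu2 c : R) (N : nat)
    (x : N.-tuple bool -> R) (U : seq bool -> R) :
  prices_in_01 nu1 nu2 c N -> fair_value nu1 nu2 c x U ->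
  lowerE nu1 nu2 c x = (U [::])%:E.
Proof.
move=> p01 /fair_valueN fU; apply/eqP; rewrite eq_le; apply/andP; split.
  apply: ge_ereal_sup => _ [a [P hedge] <-]; rewrite lee_fin -lerN2.
  apply: (fair_value_le_superhedge (P := P) p01 fU) => xi.
  by rewrite opprK addrC.
apply: ereal_sup_ubound; exists (U [::]) => //.
have [P hedge] := fair_value_superhedge fU; exists P => xi.
by have := hedge xi; rewrite opprK addrC.
Qed.

(** * The Polya mixture *)

Definition rising (R : realType) (a c : R) (k : nat) : R :=
  \prod_(i < k) (a + i%:R * c).

Definition polya_mean (R : realType) (g : nat -> R) (k : nat) (a b c : R) : R :=
  \sum_(j < k.+1) g j * ('C(k, j)%:R *
    (rising a c j * rising b c (k - j) / rising (a + b) c k)).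

Lemma risingS (R : realType) (a c : R) (k : nat) :
  rising a c k.+1 = a * rising (a + c) c k.
Proof.
rewrite /rising big_ord_recl mul0r addr0; congr (_ * _).
by apply: eq_bigr => i _; rewrite /= /bump /= -natr1; ring.
Qed.

(* Pascal's rule, sorting the paths by their first draw. *)
Lemma polya_mean_rec (R : realType) (g : nat -> R) (k : nat) (a b c : R) :
  polya_mean g k.+1 a b c =
  a / (a + b) * polya_mean (fun j => g j.+1) k (a + c) b c +
  b / (a + b) * polya_mean g k a (b + c) c.
Proof.
(* The weight in [T j] belongs to one fixed path with j red draws; it does not depend on their
   order. Splitting by the first draw, [T j.+1] collects red and [T j] black. *)
pose T j := g j * (rising a c j * rising b c (k.+1 - j) / rising (a + b) c k.+1).
transitivity (\sum_(j < k.+1) 'C(k, j)%:R * T j.+1 +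
              \sum_(j < k.+1) 'C(k, j)%:R * T j).
  transitivity (\sum_(j < k.+2) 'C(k.+1, j)%:R * T j).
    by apply: eq_bigr => j _; rewrite /T; ring.
  (* The sum may be extended to j = k + 1, where 'C(k, k + 1) = 0, before its first term is split
     off. *)
  have -> : \sum_(j < k.+1) 'C(k, j)%:R * T j =
      T 0%N + \sum_(j < k.+1) 'C(k, j.+1)%:R * T j.+1.
    transitivity (\sum_(j < k.+2) 'C(k, j)%:R * T j).
      by rewrite [RHS]big_ord_recr /= (bin_small (ltnSn k)) mul0r addr0.
    by rewrite big_ord_recl bin0 mul1r.
  rewrite big_ord_recl bin0 mul1r addrCA -big_split; congr (_ + _).
  by apply: eq_bigr => j _; rewrite /= /bump /= add1n binS natrD; ring.
rewrite !mulr_sumr; congr (_ + _); apply: eq_bigr => j _; rewrite /T.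
  by rewrite subSS !risingS invfM addrAC; ring.
have jk : (j <= k)%N by rewrite -ltnS.
by rewrite subSn // !risingS invfM addrA; ring.
Qed.

(** After [s] the game is again a Polya urn, with its current red and black contents, [N - size s]
    draws to go and the payoff shifted by the reds already drawn. *)
Lemma polya_mean_eta (R : realType) (N : nat) (nu1 nu2 c : R)
    (eta : 'I_N.+1 -> R) :
  prices_in_01 nu1 nu2 c N ->
  fair_value nu1 nu2 c (eta_ones eta) (fun s =>
    polya_mean (fun j => eta (inord (ones s + j))) (N - size s)
      (nu1 + c * (ones s)%:R) (nu2 + c * ((size s)%:R - (ones s)%:R)) c).
Proof.
move=> p01; split=> [xi|s sN us].
  rewrite size_tuple subnn /polya_mean big_ord1 addn0 /rising !big_ord0.
  by rewrite bin0 invr1 !mulr1.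
have [t0 _] := p01 s sN us.
have tE : urn_total nu1 nu2 c s =
    (nu1 + c * (ones s)%:R) + (nu2 + c * ((size s)%:R - (ones s)%:R)).
  by rewrite /urn_total; ring.
rewrite !size_rcons !ones_rcons /= -(subnSK sN) polya_mean_rec /price -tE.
congr (_ * _ + _ * _).
- congr polya_mean; rewrite -?natr1 ?natrD; try ring.
  by apply/boolp.funext => j; congr (eta (inord _)); lia.
(* [1 - price] is the share of black balls; this uses the nonzero total granted by
   [prices_in_01]. *)
- by apply: (mulIf t0); rewrite mulrBl !mulfVK // tE; ring.
- congr polya_mean; rewrite -?natr1 ?natrD; try ring.
  by apply/boolp.funext => j; congr (eta (inord _)); lia.
Qed.

Lemma upper_lower_polya_mean (R : realType) (N : nat) (nu1 nu2 c : R)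
    (eta : 'I_N.+1 -> R) (v : R) :
  prices_in_01 nu1 nu2 c N ->
  polya_mean (fun j => eta (inord j)) N nu1 nu2 c = v ->
  upperE nu1 nu2 c (eta_ones eta) = v%:E /\
  lowerE nu1 nu2 c (eta_ones eta) = v%:E.
Proof.
move=> p01 vE; have fU := polya_mean_eta eta p01.
rewrite (fair_value_upperE p01 fU) (fair_value_lowerE p01 fU).
by rewrite /ones big_nil subn0 subrr mulr0 !addr0 vE.
Qed.

(** * The three formulas *)

Lemma gbinom_rising (R : realType) (a c : R) (k : nat) : c != 0 ->
  gbinom (- a / c) k = (- c^-1) ^+ k * rising a c k / (k`!)%:R.
Proof.
move=> c0; congr (_ / _); rewrite -[k in _ ^+ k]card_ord -prodrMl.
by apply: eq_bigr => i _; field.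
Qed.

Lemma bin_fact_div (R : realType) (n m : nat) : (m <= n)%N ->
  'C(n, m)%:R = (n`!)%:R / ((m`!)%:R * ((n - m)`!)%:R) :> R.
Proof.
move=> mn; apply: (mulIf (x := (m`!)%:R * ((n - m)`!)%:R)).
  by rewrite mulf_neq0 // pnatr_eq0 -lt0n fact_gt0.
rewrite divfK; first by rewrite -!natrM bin_fact.
by rewrite mulf_neq0 // pnatr_eq0 -lt0n fact_gt0.
Qed.

(** The powers of [- c^-1] cancel since m + (N - m) = N, and the factorials of the three [gbinom]
    combine into 'C(N, m). *)
Lemma polya_mean_formula (R : realType) (N : nat) (nu1 nu2 c : R)
    (eta : 'I_N.+1 -> R) : c != 0 ->
  polya_mean (fun j => eta (inord j)) N nu1 nu2 c = polya_formula nu1 nu2 eta c.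
Proof.
move=> c0; apply: eq_bigr => m _; rewrite inord_val; congr (_ * _).
have mN : (m <= N)%N by rewrite -ltnS.
rewrite !gbinom_rising // bin_fact_div // !invfM invrK.
have -> : (- c^-1) ^+ N = (- c^-1) ^+ m * (- c^-1) ^+ (N - m).
  by rewrite -exprD subnKC.
have q0 n : (- c^-1) ^+ n != 0 by rewrite expf_neq0 // oppr_eq0 invr_eq0.
rewrite invfM.
set u := _ ^+ m; set v := _ ^+ (N - m).
have uu : u / u = 1 by rewrite divff ?q0.
have vv : v / v = 1 by rewrite divff ?q0.
set A := rising nu1 c m; set B := rising nu2 c _; set D := (rising _ _ N)^-1.
set F := (N`!)%:R; set G := (m`!)%:R^-1; set H := ((N - m)`!)%:R^-1.
transitivity ((u / u) * (v / v) * (F * (G * H) * (A * B * D))).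
  by rewrite uu vv !mul1r.
ring.
Qed.

Lemma polya_mean_binomial (R : realType) (N : nat) (nu1 nu2 : R)
    (eta : 'I_N.+1 -> R) : nu1 + nu2 != 0 ->
  polya_mean (fun j => eta (inord j)) N nu1 nu2 0 = binomial_formula nu1 nu2 eta.
Proof.
move=> t0; apply: eq_bigr => m _; rewrite inord_val.
have rising0 (a : R) k : rising a 0 k = a ^+ k.
  rewrite /rising -[k in RHS]card_ord -prodr_const.
  by apply: eq_bigr => i _; rewrite mulr0 addr0.
have -> : 1 - nu1 / (nu1 + nu2) = nu2 / (nu1 + nu2) by field.
have mN : (m <= N)%N by rewrite -ltnS.
rewrite !rising0 !expr_div_n -[in _ ^+ N](subnKC mN) exprD invfM; ring.
Qed.

(** For k > n both sides vanish, the product through its factor n - n. *)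
Lemma rising_ffact (R : realType) (n k : nat) :
  rising n%:R (-1) k = (n ^_ k)%:R :> R.
Proof.
elim: k n => [|k IHk] [|n]; rewrite ?risingS /rising ?big_ord0 ?ffactn0 //.
  by rewrite mul0r ffact0n.
by rewrite -/(rising _ _ _) -natr1 addrK IHk natr1 ffactSS natrM.
Qed.

Lemma polya_mean_hypergeometric (R : realType) (N n1 n2 : nat)
    (eta : 'I_N.+1 -> R) :
  polya_mean (fun j => eta (inord j)) N n1%:R n2%:R (-1) =
  hypergeometric_formula n1 n2 eta.
Proof.
rewrite /hypergeometric_formula big_mkcond; apply: eq_bigr => m _ /=.
have mN : (m <= N)%N by rewrite -ltnS.
rewrite inord_val -natrD !rising_ffact -!bin_ffact !natrM.
have f0 n : (n`!)%:R != 0 :> R by rewrite pnatr_eq0 -lt0n fact_gt0.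
transitivity (eta m * ('C(n1, m)%:R * 'C(n2, N - m)%:R / 'C(n1 + n2, N)%:R)).
  rewrite bin_fact_div // [in LHS](invfM 'C(n1 + n2, N)%:R).
  set d := 'C(n1 + n2, N)%:R^-1; congr (_ * _).
  by field; rewrite !f0.
(* Outside the summation range one of the two numerator binomials is zero. *)
case: ifPn => // out.
suff -> : 'C(n1, m)%:R * 'C(n2, N - m)%:R = 0 :> R by rewrite mul0r mulr0.
rewrite -natrM; apply/eqP; rewrite pnatr_eq0 muln_eq0.
have [n1m|n1m] := ltnP n1 m; first by rewrite bin_small.
by rewrite (@bin_small n2) ?orbT //; lia.
Qed.

(** Each rising product is a polynomial in c, and the denominator tends to (a + b)^k, which is
    nonzero. *)
Lemma polya_mean_cvg (R : realType) (g : nat -> R) (k : nat) (a b : R) :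
  a + b != 0 ->
  polya_mean g k a b c @[c --> (0 : R)^'] --> polya_mean g k a b 0.
Proof.
move=> t0; have rising_cvg (d : R) j :
    rising d c j @[c --> (0 : R)^'] --> rising d 0 j.
  pose q := \prod_(i < j) (d%:P + i%:R%:P * 'X).
  have qE c : rising d c j = q.[c].
    by rewrite horner_prod; apply: eq_bigr => i _; rewrite !hornerE.
  rewrite qE; under boolp.eq_fun do rewrite qE.
  apply: cvg_within_filter; exact: continuous_horner.
rewrite /polya_mean; apply: cvg_big => [|j _]; first exact: add_continuous.
apply: cvgMl_tmp; apply: cvgMl_tmp; apply: cvgM; first exact: cvgM.
apply: cvgV; last exact: rising_cvg.
by apply/prodf_neq0 => i _; rewrite mulr0 addr0.
Qed.

Theorem mainTheorem4 (R : realType) (N : nat) (nu1 nu2 c : R)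
    (eta : 'I_N.+1 -> R)
    (nu1_gt0 : 0 < nu1) (nu2_gt0 : 0 < nu2) (le_N_nu : N%:R <= nu1 + nu2)
    (prices01 : prices_in_01 nu1 nu2 c N) :
  [/\ c != 0 ->
        upperE nu1 nu2 c (eta_ones eta) = (polya_formula nu1 nu2 eta c)%:E /\
        lowerE nu1 nu2 c (eta_ones eta) = (polya_formula nu1 nu2 eta c)%:E,
      polya_formula nu1 nu2 eta c' @[c' --> (0 : R)^'] -->
        binomial_formula nu1 nu2 eta,
      c = 0 ->
        upperE nu1 nu2 c (eta_ones eta) = (binomial_formula nu1 nu2 eta)%:E /\
        lowerE nu1 nu2 c (eta_ones eta) = (binomial_formula nu1 nu2 eta)%:E
    & forall n1 n2 : nat, c = -1 -> nu1 = n1%:R -> nu2 = n2%:R ->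
        upperE nu1 nu2 c (eta_ones eta)
          = (hypergeometric_formula n1 n2 eta)%:E /\
        lowerE nu1 nu2 c (eta_ones eta)
          = (hypergeometric_formula n1 n2 eta)%:E].
Proof.
have t0 : nu1 + nu2 != 0 by rewrite gt_eqF ?addr_gt0.
split.
- by move=> c0; apply: upper_lower_polya_mean => //; apply: polya_mean_formula.
- rewrite -polya_mean_binomial //.
  (* The punctured neighbourhood excludes c' = 0, so there the formula agrees with the continuous
     [polya_mean]. *)
  have := @polya_mean_cvg _ (fun j => eta (inord j)) N _ _ t0.
  apply: cvg_trans; apply: near_eq_cvg.
  by near=> d; apply: polya_mean_formula; near: d; apply: nbhs_dnbhs_neq.
- move=> c0; apply: upper_lower_polya_mean => //.
  by rewrite c0; apply: polya_mean_binomial.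
- move=> n1 n2 c1 nu1E nu2E; apply: upper_lower_polya_mean => //.
  by rewrite c1 nu1E nu2E; apply: polya_mean_hypergeometric.
Unshelve. all: by end_near.
Qed.
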